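(* Let $\lambda\in\mathbb{C}$, $\lambda\ne1$, $\alpha\in\mathbb{C}$, $c\in\mathbb{C}\setminus\{0\}$, and let $S_n(x)\sim\left(\left(\frac{e^t-\lambda}{1-\lambda}\right)^{\alpha},\ \frac{\log(1+t)}{(1+t)^c}\right)$. Then for $n\ge1$, $$S_n(x)=\sum_{l=0}^{n-1}\binom{n-1}{l}B_l^{(l-n+1)}(cn+1)\,H_{n-l}^{(\alpha)}(x\mid\lambda).$$
   Context: For invertible $g(t)$ (nonzero constant term) and delta series $f(t)$ ($f(0)=0$, nonzero coefficient of $t$), the Sheffer sequence $S_n(x)\sim(g(t),f(t))$ is the unique polynomial sequence with $\sum_{k\ge0}S_k(y)\frac{t^k}{k!}=\frac{1}{g(\bar f(t))}e^{y\bar f(t)}$ for all $y\in\mathbb{C}$, where $\bar f$ is the compositional inverse of $f$. Complex powers of series with constant term $1$ are defined by $h^a=\exp(a\log h)$. The Bernoulli polynomials of order $a$ are defined by $\left(\frac{t}{e^t-1}\right)^a e^{xt}=\sum_{n\ge0}B_n^{(a)}(x)\frac{t^n}{n!}$. The Frobenius–Euler polynomials of order $\alpha$ are defined by $\left(\frac{1-\lambda}{e^t-\lambda}\right)^{\alpha} e^{xt}=\sum_{n\ge0}H_n^{(\alpha)}(x\mid\lambda)\frac{t^n}{n!}$. *)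

(* Defs.v *)
(* Formal power series over a field K of characteristic 0,
   represented by their coefficient functions nat -> K. *)
From HB Require Import structures.
From mathcomp Require Import all_boot all_order all_algebra.
Set Implicit Arguments. Unset Strict Implicit. Unset Printing Implicit Defensive.
Import Order.TTheory GRing.Theory Num.Theory.
Local Open Scope ring_scope.

Definition fps (K : fieldType) := nat -> K.

Section FPS.
Variable K : fieldType.
Implicit Types (f g h : fps K) (a : K).

Definition fconst a : fps K := fun n => if n == 0%N then a else 0.
Definition fone : fps K := fconst 1.
Definition fX : fps K := fun n => if n == 1%N then 1 else 0.
Definition fadd f g : fps K := fun n => f n + g n.
Definition fsub f g : fps K := fun n => f n - g n.
Definition fscale a f : fps K := fun n => a * f n.
Definition fmul f g : fps K := fun n => \sum_(i < n.+1) f i * g (n - i)%N.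
Definition fpown f (k : nat) : fps K := iter k (fmul f) fone.

(* composition f(h(t)), meaningful when h 0 = 0 *)
Definition fcomp f h : fps K := fun n => \sum_(k < n.+1) f k * fpown h k n.

(* exp(f) = sum_k f^k / k!, for f 0 = 0 *)
Definition fexp f : fps K := fun n => \sum_(k < n.+1) fpown f k n / (k`!)%:R.

(* log(h) = sum_{k>=1} (-1)^(k+1) (h-1)^k / k, for h 0 = 1 *)
Definition flog h : fps K := fun n =>
  \sum_(1 <= k < n.+1) (-1) ^+ k.+1 / k%:R * fpown (fsub h fone) k n.

(* complex (here: field-element) power h^a = exp(a log h), for h 0 = 1 *)
Definition fpowc h a : fps K := fexp (fscale a (flog h)).

(* multiplicative inverse 1/g for g 0 != 0: (1/g0) * sum_k (1 - g/g0)^k *)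
Definition finv g : fps K := fun n =>
  (g 0%N)^-1 * \sum_(k < n.+1) fpown (fsub fone (fscale (g 0%N)^-1 g)) k n.

Definition fet : fps K := fexp fX.

(* Sheffer sequence S_n ~ (g, f): g invertible, f a delta series, and with
   fb the compositional inverse of f,
   sum_k S_k(y) t^k/k! = 1/g(fb(t)) * e^{y fb(t)} for all y. *)
Definition sheffer (g f : fps K) (S : nat -> {poly K}) : Prop :=
  g 0%N != 0 /\ f 0%N = 0 /\ f 1%N != 0 /\
  exists fb : fps K, fb 0%N = 0 /\ fcomp f fb = fX /\
    forall (y : K) (n : nat),
      (S n).[y] / (n`!)%:R = fmul (finv (fcomp g fb)) (fexp (fscale y fb)) n.

(* t/(e^t - 1) as the inverse of (e^t-1)/t = sum_n t^n/(n+1)! *)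
Definition fbern_base : fps K := finv (fun n => ((n.+1)`!)%:R^-1).

Definition bernoulli_ord (a : K) (n : nat) (x : K) : K :=
  (n`!)%:R * fmul (fpowc fbern_base a) (fexp (fscale x fX)) n.

(* Frobenius-Euler polynomial of order al:
   ((1-lam)/(e^t-lam))^al e^{xt} = sum H_n^(al)(x|lam) t^n/n!.
   The power is taken of the series (1-lam)/(e^t-lam), which has constant term 1. *)
Definition frob_base (lam : K) : fps K :=
  fscale (1 - lam) (finv (fsub fet (fconst lam))).
Definition frob_euler (lam al : K) (n : nat) (x : K) : K :=
  (n`!)%:R * fmul (fpowc (frob_base lam) al) (fexp (fscale x fX)) n.

Definition gser (lam al : K) : fps K :=
  fpowc (fscale (1 - lam)^-1 (fsub fet (fconst lam))) al.

Definition fser (c : K) : fps K :=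
  fmul (flog (fadd fone fX)) (fpowc (fadd fone fX) (- c)).

End FPS.

(* Main.v *)
(* The generating function of [S_n] is [H o fb] with
   [H = ((1 - lam) / (e^t - lam))^alpha e^(xt)] and [fb] inverse to
   [f = log(1 + t) / (1 + t)^c]. Lagrange inversion gives
   [n [t^n] (H o fb) = [t^(n-1)] H' (t / f)^n], where
   [(t / f)^n = (t / log(1 + t))^n (1 + t)^(cn)]. The substitution
   [t = e^u - 1] in a residue identifies the [t^l] coefficient of the latter
   with that of [(u / (e^u - 1))^(l-n+1) e^((cn+1)u)], which is
   [B_l^(l-n+1)(cn + 1) / l!]. Powers and exponentials are handled as the unique
   solutions of first-order linear differential equations. *)
Require Import Defs.
From HB Require Import structures.
From mathcomp Require Import all_boot all_order all_algebra.
From mathcomp Require Import boolp.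
From mathcomp Require Import ring.
Import Order.TTheory GRing.Theory Num.Theory.
(* [finv] must denote the power series inverse rather than that of [fingraph]. *)
Import Defs.
Local Open Scope ring_scope.
Set Implicit Arguments. Unset Strict Implicit. Unset Printing Implicit Defensive.

(** * The algebra of formal power series over a field *)

Section FpsRing.
Variable K : fieldType.
Implicit Types (f g h : fps K) (a : K).

Definition fopp f : fps K := fun n => - f n.

(** Classical axioms supply the decidable equality and choice on coefficient functions that the
    algebraic hierarchy demands. *)
HB.instance Definition _ := gen_eqMixin (fps K).
HB.instance Definition _ := gen_choiceMixin (fps K).

Fact faddA : associative (@fadd K).
Proof. by move=> f g h; apply: funext => n; rewrite /fadd addrA. Qed.
Fact faddC : commutative (@fadd K).
Proof. by move=> f g; apply: funext => n; rewrite /fadd addrC. Qed.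
Fact fadd0 : left_id (fconst 0) (@fadd K).
Proof. by move=> f; apply: funext => n; rewrite /fadd /fconst if_same add0r. Qed.
Fact faddN : left_inverse (fconst 0) fopp (@fadd K).
Proof.
by move=> f; apply: funext => n; rewrite /fadd /fopp /fconst if_same addNr.
Qed.
HB.instance Definition _ := GRing.isZmodule.Build (fps K) faddA faddC fadd0 faddN.

Lemma coef_poly_trunc f N i : (i < N)%N -> (\poly_(j < N) f j)`_i = f i.
Proof. by rewrite coef_poly => ->. Qed.

(** Coefficient [n] of a product only reads coefficients up to [n], so identities of [{poly K}]
    transfer to series by truncation. *)
Lemma fmul_poly f g (p q : {poly K}) n :
  (forall i, (i <= n)%N -> p`_i = f i) -> (forall i, (i <= n)%N -> q`_i = g i) ->
  fmul f g n = (p * q)`_n.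
Proof.
move=> Hp Hq; rewrite coefM; apply: eq_bigr => i _.
by rewrite Hp -1?ltnS// Hq// leq_subr.
Qed.

Fact fmulA : associative (@fmul K).
Proof.
move=> f g h; apply: funext => n.
set T := fun f : fps K => \poly_(j < n.+1) f j.
have HT u i : (i <= n)%N -> (T u)`_i = u i by move=> ?; exact: coef_poly_trunc.
have HM u v i : (i <= n)%N -> (T u * T v)`_i = fmul u v i.
  move=> le_in; rewrite -(@fmul_poly u v) // => j le_ji; apply: HT; exact: leq_trans le_in.
rewrite (@fmul_poly _ _ (T f) (T g * T h)) ?mulrA; [|exact: HT|exact: HM].
by rewrite (@fmul_poly _ _ (T f * T g) (T h)); [|exact: HM|exact: HT].
Qed.

Fact fmulC : commutative (@fmul K).
Proof.
move=> f g; apply: funext => n; set T := fun f : fps K => \poly_(j < n.+1) f j.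
have HT u i : (i <= n)%N -> (T u)`_i = u i by move=> ?; exact: coef_poly_trunc.
by rewrite (fmul_poly (HT f) (HT g)) (fmul_poly (HT g) (HT f)) mulrC.
Qed.

Lemma fmul_const a f n : fmul (fconst a) f n = a * f n.
Proof.
rewrite /fmul big_ord_recl subn0 big1 ?addr0// => i _.
by rewrite /fconst /= mul0r.
Qed.

Fact fmul1 : left_id (fone K) (@fmul K).
Proof. by move=> f; apply: funext => n; rewrite fmul_const mul1r. Qed.

Fact fmulDl : left_distributive (@fmul K) (@fadd K).
Proof.
move=> f g h; apply: funext => n; rewrite /fadd /fmul -big_split.
by apply: eq_bigr => i _; rewrite mulrDl.
Qed.

Fact fone_neq0 : fone K != 0.
Proof.
by apply/eqP => /(congr1 (fun f : fps K => f 0%N)) /eqP; rewrite oner_eq0.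
Qed.

HB.instance Definition _ :=
  GRing.Zmodule_isComNzRing.Build (fps K) fmulA fmulC fmul1 fmulDl fone_neq0.

Fact fscaleA a b f : fscale a (fscale b f) = fscale (a * b) f.
Proof. by apply: funext => n; rewrite /fscale mulrA. Qed.
Fact fscale1 : left_id 1 (@fscale K).
Proof. by move=> f; apply: funext => n; rewrite /fscale mul1r. Qed.
Fact fscaleDr : right_distributive (@fscale K) +%R.
Proof. by move=> a f g; apply: funext => n; exact: mulrDr. Qed.
Fact fscaleDl f : {morph (@fscale K)^~ f : a b / a + b}.
Proof. by move=> a b; apply: funext => n; exact: mulrDl. Qed.
HB.instance Definition _ :=
  GRing.Zmodule_isLmodule.Build K (fps K) fscaleA fscale1 fscaleDr fscaleDl.

Lemma fscale_const a f : fscale a f = fconst a * f.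
Proof. by apply: funext => n; rewrite /fscale -fmul_const. Qed.

Fact fscaleAl a f g : a *: (f * g) = a *: f * g.
Proof. by rewrite /GRing.scale/= !fscale_const mulrA. Qed.
HB.instance Definition _ := GRing.Lmodule_isLalgebra.Build K (fps K) fscaleAl.
Fact fscaleAr a f g : a *: (f * g) = f * (a *: g).
Proof. by rewrite mulrC fscaleAl mulrC. Qed.
HB.instance Definition _ := GRing.Lalgebra_isAlgebra.Build K (fps K) fscaleAr.

Lemma fcoefD f g n : (f + g) n = f n + g n. Proof. by []. Qed.
Lemma fcoefN f n : (- f) n = - f n. Proof. by []. Qed.
Lemma fcoefZ a f n : (a *: f) n = a * f n. Proof. by []. Qed.
Lemma fcoef0 n : (0 : fps K) n = 0. Proof. exact: if_same. Qed.
Lemma fcoef1 n : (1 : fps K) n = (n == 0%N)%:R. Proof. by case: n. Qed.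
Lemma fcoefM f g n : (f * g) n = \sum_(i < n.+1) f i * g (n - i)%N.
Proof. by []. Qed.
Lemma fcoefM0 f g : (f * g) 0%N = f 0%N * g 0%N.
Proof. by rewrite fcoefM big_ord1. Qed.
Lemma fcoef_sum I r (P : pred I) (F : I -> fps K) n :
  (\sum_(i <- r | P i) F i) n = \sum_(i <- r | P i) F i n.
Proof. by apply: (big_morph (fun f : fps K => f n)) => //; exact: fcoef0. Qed.
Lemma fcoefMn f k n : (f *+ k) n = f n *+ k.
Proof. by elim: k => [|k IH]; rewrite ?mulr0n ?fcoef0// !mulrS fcoefD IH. Qed.
Lemma fcoefX0 f k : (f ^+ k) 0%N = f 0%N ^+ k.
Proof. by elim: k => [|k IH]; rewrite ?expr0 ?fcoef1// !exprS fcoefM0 IH. Qed.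

Lemma fpownE f k : fpown f k = f ^+ k.
Proof. by elim: k => //= k ->; rewrite exprS. Qed.

Lemma eq_fcoefM f g f' g' n : (forall i, (i <= n)%N -> f i = f' i) ->
  (forall i, (i <= n)%N -> g i = g' i) -> (f * g) n = (f' * g') n.
Proof.
move=> Hf Hg; rewrite !fcoefM; apply: eq_bigr => i _.
by rewrite Hf -1?ltnS// Hg// leq_subr.
Qed.

Notation X := (fX K).

Lemma fcoefXM f n : (X * f) n = if n is m.+1 then f m else 0.
Proof.
rewrite fcoefM big_ord_recl mul0r add0r; case: n => [|n]; first by rewrite big_ord0.
rewrite big_ord_recl big1 ?addr0 => [|i _]; last by rewrite /fX /= mul0r.
by rewrite /fX /= mul1r subn1.
Qed.

Lemma fcoefXnM f k n : (X ^+ k * f) n = if (n < k)%N then 0 else f (n - k)%N.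
Proof.
elim: k n => [|k IH] n; first by rewrite mul1r subn0.
by rewrite exprS -mulrA fcoefXM; case: n => // n; rewrite IH.
Qed.

Lemma fcoefXn k n : (X ^+ k) n = (n == k)%:R.
Proof.
rewrite -[X ^+ k]mulr1 fcoefXnM fcoef1 subn_eq0.
by rewrite eqn_leq; case: (ltnP n k); rewrite ?andbF ?andbT.
Qed.

Lemma fps_eqX f : f 0%N = 0 -> f = X * (fun n => f n.+1).
Proof. by move=> f0; apply: funext => -[|n]; rewrite fcoefXM. Qed.

Lemma fcoefX_small h k n : h 0%N = 0 -> (n < k)%N -> (h ^+ k) n = 0.
Proof. by move=> /fps_eqX -> lt_nk; rewrite exprMn fcoefXnM lt_nk. Qed.

Lemma fcoefX_diag h k : h 0%N = 0 -> (h ^+ k) k = h 1%N ^+ k.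
Proof. by move=> /fps_eqX {1}->; rewrite exprMn fcoefXnM ltnn subnn fcoefX0. Qed.

End FpsRing.

Notation X := (fX _).

(** * Composition with a series of zero constant term *)

Section Composition.
Variable K : fieldType.
Implicit Types (f g h : fps K) (a : K).

Lemma fcompE f h n : fcomp f h n = (\sum_(k < n.+1) f k *: h ^+ k) n.
Proof.
by rewrite fcoef_sum; apply: eq_bigr => k _; rewrite fpownE fcoefZ.
Qed.

Variable h : fps K.
Hypothesis h0 : h 0%N = 0.

(** As [h ^+ k] starts in degree [k] or later, the sum may be lengthened at will; all coefficients
    below a bound then share one finite sum. *)
Lemma fcomp_wide f n N : (n < N)%N -> fcomp f h n = (\sum_(k < N) f k *: h ^+ k) n.
Proof.
move=> lt_nN; rewrite fcompE !fcoef_sum.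
rewrite (big_ord_widen _ (fun k => (f k *: h ^+ k) n) lt_nN) big_mkcond /=.
apply: eq_bigr => k _; case: ltnP => // lt_nk.
by rewrite fcoefZ fcoefX_small ?mulr0.
Qed.

(** Composition agrees up to degree [n] with the ring morphism [horner_alg h], from which it
    inherits multiplicativity. *)
Lemma fcomp_poly f (p : {poly K}) n : (forall i, (i <= n)%N -> p`_i = f i) ->
  fcomp f h n = horner_alg h p n.
Proof.
move=> Hp; rewrite /horner_alg /horner_morph /=.
have lt_nN : (n < maxn n.+1 (size p))%N by rewrite leq_max leqnn.
rewrite (@horner_coef_wide _ (maxn n.+1 (size p))); last first.
  by rewrite (leq_trans (size_poly _ _)) ?leq_maxr.
rewrite (fcomp_wide _ lt_nN) !fcoef_sum; apply: eq_bigr => k _.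
rewrite coef_map /= mulr_algl !fcoefZ.
by case: (leqP k n) => [/Hp ->//|lt_nk]; rewrite fcoefX_small ?mulr0.
Qed.

Lemma fcompD f g : fcomp (f + g) h = fcomp f h + fcomp g h.
Proof.
apply: funext => n; rewrite fcoefD /fcomp -big_split.
by apply: eq_bigr => k _; rewrite fcoefD mulrDl.
Qed.

Lemma fcompZ a f : fcomp (a *: f) h = a *: fcomp f h.
Proof.
apply: funext => n; rewrite fcoefZ /fcomp mulr_sumr.
by apply: eq_bigr => k _; rewrite fcoefZ mulrA.
Qed.

Lemma fcompB f g : fcomp (f - g) h = fcomp f h - fcomp g h.
Proof. by rewrite fcompD -!scaleN1r fcompZ. Qed.

Lemma fcomp_Xn k : fcomp (X ^+ k) h = h ^+ k.
Proof.
apply: funext => n; rewrite (@fcomp_poly _ 'X^k).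
  by rewrite rmorphXn /= horner_algX.
by move=> i _; rewrite fcoefXn (poly.coefXn K).
Qed.

Lemma fcompX : fcomp X h = h.
Proof. by rewrite -[X]expr1 fcomp_Xn. Qed.

Lemma fcomp1 : fcomp 1 h = 1.
Proof. exact: (fcomp_Xn 0). Qed.

Lemma fcomp0 f : (fcomp f h) 0%N = f 0%N.
Proof. by rewrite fcompE big_ord1 expr0 fcoefZ mulr1. Qed.

Lemma fcompM f g : fcomp (f * g) h = fcomp f h * fcomp g h.
Proof.
apply: funext => n; set T := fun f : fps K => \poly_(j < n.+1) f j.
have HT u i : (i <= n)%N -> (T u)`_i = u i by move=> ?; exact: coef_poly_trunc.
rewrite (@fcomp_poly _ (T f * T g)) => [|i le_in]; last first.
  by rewrite -(@fmul_poly _ f g)// => j le_ji; apply: HT; exact: leq_trans le_in.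
rewrite rmorphM; apply: eq_fcoefM => i le_in; symmetry; apply: fcomp_poly => j le_ji;
  by apply: HT; exact: leq_trans le_in.
Qed.

Lemma fcomp_exp f k : fcomp (f ^+ k) h = fcomp f h ^+ k.
Proof. by elim: k => [|k IH]; rewrite ?expr0 ?fcomp1// !exprS fcompM IH. Qed.

(** The linear system is triangular: once the lower coefficients of the difference vanish,
    coefficient [n] of its composite is its own coefficient [n] times [h 1 ^+ n]. *)
Lemma fcomp_inj f g : h 1%N != 0 -> fcomp f h = fcomp g h -> f = g.
Proof.
move=> h1 /eqP; rewrite -subr_eq0 -fcompB => /eqP fg0.
apply/eqP; rewrite -subr_eq0; apply/eqP; move: {f g}(f - g) fg0 => f f0.
apply: funext => n; rewrite fcoef0; elim/ltn_ind: n => n IH.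
have /eqP := congr1 (fun u : fps K => u n) f0.
rewrite fcoef0 fcompE big_ord_recr /= fcoefD fcoef_sum big1 => [|k _].
  by rewrite add0r fcoefZ fcoefX_diag// mulf_eq0 expf_eq0 (negPf h1) andbF orbF => /eqP.
by rewrite fcoefZ IH ?mul0r.
Qed.

End Composition.

Lemma fcompXr (K : fieldType) (f : fps K) : fcomp f X = f.
Proof.
apply: funext => n; rewrite fcompE fcoef_sum big_ord_recr /= big1 => [|k _].
  by rewrite add0r fcoefZ fcoefXn eqxx mulr1.
by rewrite fcoefZ fcoefXn gtn_eqF ?mulr0.
Qed.

Lemma fcompA (K : fieldType) (f g h : fps K) : g 0%N = 0 -> h 0%N = 0 ->
  fcomp (fcomp f g) h = fcomp f (fcomp g h).
Proof.
move=> g0 h0; apply: funext => n; rewrite fcompE fcoef_sum.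
(* The inner sums are widened to a common range so that the two summations can be exchanged. *)
under eq_bigr => k _ do
  rewrite fcoefZ (fcomp_wide g0 f (ltn_ord k)) fcoef_sum mulr_suml.
rewrite exchange_big fcompE fcoef_sum; apply: eq_bigr => j _.
rewrite fcoefZ -fcomp_exp// fcompE fcoef_sum mulr_sumr; apply: eq_bigr => k _.
by rewrite !fcoefZ mulrA.
Qed.

(** * Multiplicative inverses *)

Section Inverse.
Variable K : fieldType.
Implicit Types (f g h : fps K).

Definition fgeom : fps K := fun=> 1.

Lemma fgeomE : fgeom * (1 - X) = 1.
Proof.
apply: funext => n; rewrite mulrC mulrBl mul1r fcoefD fcoefN fcoefXM fcoef1.
by case: n => [|n]; rewrite ?subr0 ?subrr.
Qed.

Lemma finvE g : finv g = (g 0%N)^-1 *: fcomp fgeom (1 - (g 0%N)^-1 *: g).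
Proof.
apply: funext => n; rewrite fcoefZ; congr (_ * _); apply: eq_bigr => k _.
by rewrite mul1r.
Qed.

Lemma finvP g : g 0%N != 0 -> finv g * g = 1.
Proof.
move=> g0; rewrite finvE -scalerAl scalerAr.
set u := _ *: g; have u0 : (1 - u) 0%N = 0.
  by rewrite fcoefD fcoefN /u fcoefZ mulVf// subrr.
(* Since [u = 1 - (1 - u)], both factors are composites with [1 - u], and the product is
   [fgeom * (1 - X)] composed with [1 - u]. *)
by rewrite -{2}[u](subKr 1) -{2}(fcompX u0) -{2}(fcomp1 u0) -fcompB -fcompM// fgeomE fcomp1.
Qed.

Lemma finv_unique g f : f * g = 1 -> finv g = f.
Proof.
move=> fg; have g0 : g 0%N != 0.
  apply: contra_eq_neq fg => g0; apply/eqP => /(congr1 (fun u : fps K => u 0%N)) /eqP.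
  by rewrite fcoefM0 g0 mulr0 fcoef1 eq_sym oner_eq0.
by rewrite -[finv g]mulr1 -fg mulrCA finvP// mulr1.
Qed.

End Inverse.

(** * The formal derivative *)

Section Derivation.
Variable K : fieldType.
Implicit Types (f g h u : fps K) (a : K).

Definition fder f : fps K := fun n => f n.+1 *+ n.+1.

Lemma fderD f g : fder (f + g) = fder f + fder g.
Proof. by apply: funext => n; rewrite !fcoefD -mulrnDl. Qed.

Lemma fderZ a f : fder (a *: f) = a *: fder f.
Proof. by apply: funext => n; rewrite fcoefZ mulrnAr. Qed.

Lemma fderB f g : fder (f - g) = fder f - fder g.
Proof. by rewrite fderD -!scaleN1r fderZ. Qed.

Lemma fder0 : fder 0 = 0.
Proof. by rewrite -(scale0r (0 : fps K)) fderZ !scale0r. Qed.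

Lemma fder1 : fder 1 = 0.
Proof. by apply: funext => n; rewrite fcoef0 /fder fcoef1 mul0rn. Qed.

Lemma fderX : fder X = 1.
Proof.
by apply: funext => -[|n]; rewrite fcoef1 // /fder /fX /= mul0rn.
Qed.

Lemma fderM f g : fder (f * g) = fder f * g + f * fder g.
Proof.
(* The truncation keeps degree [n.+1], because coefficient [n] of a derivative reads coefficient
   [n.+1]. *)
apply: funext => n; set T := fun f : fps K => \poly_(j < n.+2) f j.
have HT u i : (i <= n.+1)%N -> (T u)`_i = u i by move=> ?; exact: coef_poly_trunc.
have HT' u i : (i <= n)%N -> (T u)`_i = u i by move=> /leqW; exact: HT.
have HD u i : (i <= n)%N -> (T u)^`()`_i = fder u i.
  by move=> le_in; rewrite coef_deriv HT.
have -> : fder (f * g) n = ((T f * T g)^`())`_n.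
  by rewrite coef_deriv -(fmul_poly (HT f) (HT g)).
rewrite derivM coefD.
by rewrite -(fmul_poly (HD f) (HT' g)) -(fmul_poly (HT' f) (HD g)).
Qed.

Lemma fder_exp f k : fder (f ^+ k.+1) = (f ^+ k * fder f) *+ k.+1.
Proof.
elim: k => [|k IH]; first by rewrite mul1r.
by rewrite exprS fderM IH [in RHS]mulrS mulrnAr mulrA -exprS mulrC; congr (_ + _).
Qed.

Lemma fder_sum I r (P : pred I) (F : I -> fps K) :
  fder (\sum_(i <- r | P i) F i) = \sum_(i <- r | P i) fder (F i).
Proof. by apply: (big_morph fder); [exact: fderD | exact: fder0]. Qed.

Lemma fder_fcomp f h : h 0%N = 0 -> fder (fcomp f h) = fcomp (fder f) h * fder h.
Proof.
move=> h0; apply: funext => n.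
rewrite {1}/fder (fcomp_wide h0 f (leqnn n.+2)) -/(fder _ n) fder_sum.
rewrite big_ord_recl fderZ expr0 fder1 scaler0 add0r.
rewrite (@eq_fcoefM _ _ _ (\sum_(k < n.+1) fder f k *: h ^+ k) (fder h))//; last first.
  by move=> i; rewrite -ltnS => lt_in; exact: fcomp_wide.
congr (_ n); rewrite mulr_suml; apply: eq_bigr => k _.
by rewrite fderZ fder_exp -scalerAl -!scaler_nat !scalerA mulrC mulr_natl.
Qed.

End Derivation.

(** * Exponentials, logarithms, powers and residues in characteristic zero *)

Section CharZero.
Variable K : fieldType.
Hypothesis char0 : [pchar K] =i pred0.
Implicit Types (f g h u P Q : fps K) (a b lam al : K).

Lemma natr_neq0 n : n.+1%:R != 0 :> K.
Proof. by rewrite ((pcharf0P _).1 char0). Qed.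

Lemma fact_neq0 n : (n`!)%:R != 0 :> K.
Proof. by rewrite ((pcharf0P _).1 char0) -lt0n fact_gt0. Qed.

(** Coefficient [n] of [u * P] involves only [P 0, ..., P n], and dividing it by [n.+1] yields
    [P n.+1]. *)
Lemma ode_unique u P Q : fder P = u * P -> fder Q = u * Q ->
  P 0%N = Q 0%N -> P = Q.
Proof.
move=> DP DQ PQ0; apply: funext => n; elim/ltn_ind: n => -[|n] IH //.
apply: (mulIf (natr_neq0 n)); rewrite !mulr_natr -/(fder P n) -/(fder Q n) DP DQ.
by rewrite mulrC [u * Q]mulrC; apply: eq_fcoefM => // i; rewrite -ltnS => /IH.
Qed.

(** The series [e^X] in closed form; it presents [fexp] as a composition, to which the chain rule
    applies. *)
Definition fE : fps K := fun n => (n`!)%:R^-1.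

Lemma fexpE f : fexp f = fcomp fE f.
Proof. by apply: funext => n; apply: eq_bigr => k _; rewrite mulrC. Qed.

Lemma fder_fE : fder fE = fE.
Proof.
apply: funext => n; rewrite /fder -mulr_natr /fE factS natrM invfM mulrAC.
by rewrite mulVf ?natr_neq0// mul1r.
Qed.

Lemma fexp_fX : fexp X = fE.
Proof. by rewrite fexpE fcompXr. Qed.

Lemma fexp_at0 f : (fexp f) 0%N = 1.
Proof. by rewrite fexpE fcomp0 /fE invr1. Qed.

Lemma fder_fexp f : f 0%N = 0 -> fder (fexp f) = fder f * fexp f.
Proof. by move=> f0; rewrite fexpE fder_fcomp// fder_fE mulrC. Qed.

(** Both sides solve [y' = (f' + g') y] with constant term 1. *)
Lemma fexpD f g : f 0%N = 0 -> g 0%N = 0 -> fexp (f + g) = fexp f * fexp g.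
Proof.
move=> f0 g0; apply: (@ode_unique (fder f + fder g)).
- by rewrite fder_fexp ?fderD// fcoefD f0 g0 addr0.
- rewrite fderM !fder_fexp//; ring.
- by rewrite fcoefM0 !fexp_at0 mulr1.
Qed.

Lemma fcomp_fexp f h : f 0%N = 0 -> h 0%N = 0 ->
  fcomp (fexp f) h = fexp (fcomp f h).
Proof. by move=> f0 h0; rewrite !fexpE fcompA. Qed.

(** The series of [log (1 + X)], which presents [flog] as a composition. *)
Definition fL : fps K := fun n => if n is m.+1 then (-1) ^+ m / m.+1%:R else 0.

Lemma flogE h : flog h = fcomp fL (h - 1).
Proof.
apply: funext => n; rewrite /flog /fcomp big_ord_recl mul0r add0r.
rewrite big_add1 big_mkord; apply: eq_bigr => k _.
by rewrite /fL /= !exprS !mulN1r opprK.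
Qed.

Lemma fder_fL : fder fL * (1 + X) = 1.
Proof.
have DL n : fder fL n = (-1) ^+ n.
  by rewrite /fder -mulr_natr /fL mulfVK ?natr_neq0.
apply: funext => n; rewrite mulrC mulrDl mul1r fcoefD fcoefXM fcoef1.
case: n => [|n]; first by rewrite DL addr0.
by rewrite !DL exprS mulN1r addNr.
Qed.

Lemma flog_at0 h : (flog h) 0%N = 0.
Proof. by rewrite flogE fcomp0. Qed.

Lemma fder_flog h : h 0%N = 1 -> fder (flog h) * h = fder h.
Proof.
move=> h0; have h10 : (h - 1) 0%N = 0 by rewrite fcoefD fcoefN h0 subrr.
rewrite flogE fder_fcomp// fderB fder1 subr0 mulrAC.
suff -> : fcomp (fder fL) (h - 1) * h = 1 by rewrite mul1r.
have hE : fcomp (1 + X) (h - 1) = h by rewrite fcompD// fcomp1// fcompX// addrC subrK.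
by rewrite -[Z in _ * Z]hE -fcompM// fder_fL fcomp1.
Qed.

Lemma fpowcE h a : fpowc h a = fexp (a *: flog h).
Proof. by []. Qed.

Lemma fpowc_at0 h a : (fpowc h a) 0%N = 1.
Proof. exact: fexp_at0. Qed.

Let scale_flog_at0 h a : (a *: flog h) 0%N = 0.
Proof. by rewrite fcoefZ flog_at0 mulr0. Qed.

Lemma fder_fpowc h a : fder (fpowc h a) = a *: fder (flog h) * fpowc h a.
Proof. by rewrite fpowcE fder_fexp ?fderZ. Qed.

Lemma fpowcD h a b : fpowc h (a + b) = fpowc h a * fpowc h b.
Proof. by rewrite !fpowcE -fexpD// -scalerDl. Qed.

Lemma fpowc0 h : fpowc h 0 = 1.
Proof.
apply: (@ode_unique 0); rewrite ?fpowc_at0// ?fder1 ?mul0r//.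
by rewrite fder_fpowc scale0r mul0r.
Qed.

Lemma fpowc1 h : h 0%N = 1 -> fpowc h 1 = h.
Proof.
move=> h0; apply: (@ode_unique (fder (flog h))); last by rewrite fpowc_at0.
- by rewrite fder_fpowc scale1r.
- by rewrite fder_flog.
Qed.

Lemma fpowc_mulrn h a n : fpowc h (a *+ n) = fpowc h a ^+ n.
Proof.
by elim: n => [|n IH]; rewrite ?mulr0n ?fpowc0// mulrS exprS fpowcD IH.
Qed.

(** The logarithmic derivatives of [h] and [k] are opposite, so the product of the powers has
    derivative zero. *)
Lemma fpowc_inv h k a : h 0%N = 1 -> h * k = 1 -> fpowc h a * fpowc k a = 1.
Proof.
move=> h0 hk; have k0 : k 0%N = 1.
  by have := congr1 (fun u : fps K => u 0%N) hk; rewrite fcoefM0 h0 mul1r.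
apply: (@ode_unique 0); rewrite ?fcoefM0 ?fpowc_at0 ?mulr1// ?fder1 ?mul0r//.
have Dh : fder (flog h) = fder h * k by rewrite -(fder_flog h0) -mulrA hk mulr1.
have Dk : fder (flog k) = fder k * h.
  by rewrite -(fder_flog k0) -mulrA [k * h]mulrC hk mulr1.
rewrite fderM !fder_fpowc Dh Dk -!scalerAl -scalerAr -scalerDr.
have := congr1 (@fder K) hk; rewrite fderM fder1 => /eqP.
rewrite addrC addr_eq0 => /eqP E.
suff -> : fder h * k * fpowc h a * fpowc k a + fpowc h a * (fder k * h * fpowc k a) = 0.
  by rewrite scaler0.
transitivity ((h * fder k + fder h * k) * fpowc h a * fpowc k a); first by ring.
by rewrite E addNr !mul0r.
Qed.

(* The invariance of the residue of [W / t^(n+1)] under the substitution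
   [t = f], stated without Laurent series: [phi] is [X / f]. *)
Lemma residue_subst f psi phi W n : f = X * psi -> phi * psi = 1 ->
  (fcomp W f * fder f * phi ^+ n.+1) n = W n.
Proof.
move=> fE phipsi; have f0 : f 0%N = 0 by rewrite fE fcoefXM.
rewrite -mulrA; set G := fder f * _.
rewrite (@eq_fcoefM _ _ _ (\sum_(k < n.+1) W k *: f ^+ k) G)//; last first.
  by move=> i; rewrite -ltnS => lt_in; exact: fcomp_wide.
have Dphi : phi ^+ 2 * fder psi = - fder phi.
  have := congr1 (@fder K) phipsi; rewrite fderM fder1.
  move=> /(congr1 (GRing.mul phi)).
  rewrite mulr0 => /eqP; rewrite mulrDr addrC addr_eq0 => /eqP.
  by rewrite mulrA -expr2 => ->; rewrite mulrCA phipsi mulr1.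
(* This coefficient is the residue of [f' / f^(m+1)], which is a derivative unless [m = 0]. *)
have term m k : (f ^+ k * (fder f * phi ^+ (m + k).+1)) (m + k)%N = (m == 0)%:R.
  have -> : f ^+ k * (fder f * phi ^+ (m + k).+1) =
      X ^+ k * (phi ^+ m + X * (phi ^+ m.+1 * fder psi)).
    rewrite fE fderM fderX mul1r exprMn -addSn exprD.
    transitivity (X ^+ k * (phi * psi) ^+ k * (phi ^+ m.+1 * (psi + X * fder psi))).
      by rewrite exprMn; ring.
    by rewrite phipsi expr1n mulr1 mulrDr {1}exprSr -mulrA phipsi mulr1 [_ * (X * _)]mulrCA.
  rewrite fcoefXnM ltnNge leq_addl /= addnK fcoefD fcoefXM.
  case: m => [|m]; first by rewrite addr0.
  (* Here [phi^(m+2) psi' = - phi^m phi' = - (phi^(m+1))' / (m+1)], whose coefficient [m] cancels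
     coefficient [m+1] of [phi^(m+1)]. *)
  rewrite !exprS mulrA -expr2 mulrAC Dphi mulNr mulrC fcoefN.
  apply: (mulIf (natr_neq0 m)); rewrite mulrDl mul0r mulNr !mulr_natr.
  by rewrite -exprSr -(fcoefMn (_ * _)) [fder phi * _]mulrC -fder_exp subrr.
rewrite mulr_suml fcoef_sum big_ord_recr /= big1 => [|k _].
  by rewrite add0r -scalerAl fcoefZ (term 0%N) mulr1.
have := term (n - k)%N k; rewrite (subnK (ltnW (ltn_ord k))) -/G => term_k.
rewrite -scalerAl fcoefZ term_k.
by rewrite subn_eq0 leqNgt ltn_ord mulr0.
Qed.

(** * The Frobenius-Euler factor *)

Lemma frob_base_inv lam : lam != 1 ->
  frob_base lam * ((1 - lam)^-1 *: (fet K - fconst lam)) = 1.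
Proof.
move=> lam1; have lam1' : 1 - lam != 0 by rewrite subr_eq0 eq_sym.
have u0 : (fet K - fconst lam) 0%N != 0 by rewrite fcoefD fcoefN /fet fexp_at0.
rewrite /frob_base -scalerAr -scalerAl scalerA mulVf// scale1r.
exact: finvP u0.
Qed.

(** The two series are powers, with the same exponent, of mutually inverse series. *)
Lemma finv_gser lam al : lam != 1 ->
  finv (gser lam al) = fpowc (frob_base lam) al.
Proof.
move=> lam1; apply: finv_unique; apply: fpowc_inv; last exact: frob_base_inv.
have lam1' : 1 - lam != 0 by rewrite subr_eq0 eq_sym.
have := congr1 (fun u : fps K => u 0%N) (frob_base_inv lam1).
by rewrite fcoefM0 fcoefZ fcoefD fcoefN /fet fexp_at0 mulVf// mulr1.
Qed.

(** * The substitution of [log (1 + X)] and the Bernoulli factor *)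

Definition flog1X : fps K := flog (1 + X).

Lemma flog1X_at0 : flog1X 0%N = 0.
Proof. exact: flog_at0. Qed.

Lemma onePlusX_at0 : (1 + X : fps K) 0%N = 1.
Proof. by rewrite fcoefD addr0. Qed.

Lemma fder_flog1X : fder flog1X * (1 + X) = 1.
Proof. by rewrite fder_flog ?onePlusX_at0// fderD fder1 fderX add0r. Qed.

Lemma flog1X_at1 : flog1X 1%N = 1.
Proof.
have := congr1 (fun u : fps K => u 0%N) fder_flog1X.
by rewrite fcoefM0 onePlusX_at0 mulr1.
Qed.

(* [log (1 + X) / X] *)
Definition flogq : fps K := fun n => flog1X n.+1.

Lemma flog1X_factor : flog1X = X * flogq.
Proof. exact: fps_eqX flog1X_at0. Qed.

Lemma flogqV : finv flogq * flogq = 1.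
Proof. by apply: finvP; rewrite /flogq flog1X_at1 oner_neq0. Qed.

Lemma scaleX_at0 a : (a *: X : fps K) 0%N = 0.
Proof. by rewrite fcoefZ mulr0. Qed.

Lemma fcomp_fexp_flog a : fcomp (fexp (a *: X)) flog1X = fpowc (1 + X) a.
Proof. by rewrite fcomp_fexp ?scaleX_at0 ?flog1X_at0// fcompZ fcompX ?flog1X_at0. Qed.

(* [(e^X - 1) / X] *)
Definition fexpq : fps K := fun n => ((n.+1)`!)%:R^-1.

Lemma fexpq_factor : fexp X - 1 = X * fexpq.
Proof.
rewrite [LHS]fps_eqX; last by rewrite fcoefD fcoefN fexp_at0 subrr.
congr (_ * _); apply: funext => n.
by rewrite fexp_fX fcoefD fcoefN fcoef1 subr0.
Qed.

(** The order [l - n + 1] is never positive for [l < n], so the Bernoulli base enters through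
    ordinary powers of its inverse. *)
Lemma fpowc_bern_base m : fpowc (fbern_base K) (- m%:R) = fexpq ^+ m.
Proof.
have q0 : fexpq 0%N = 1 by rewrite /fexpq invr1.
have qB : fbern_base K * fexpq = 1 by apply: (@finvP _ fexpq); rewrite q0 oner_neq0.
have B0 : fbern_base K 0%N = 1.
  by have := congr1 (fun u : fps K => u 0%N) qB; rewrite fcoefM0 q0 mulr1.
have Bq := fpowc_inv m%:R B0 qB.
have Bm : fpowc (fbern_base K) (- m%:R) * fpowc (fbern_base K) m%:R = 1.
  by rewrite -fpowcD addNr fpowc0.
by rewrite -[LHS]mulr1 -Bq mulrA Bm mul1r fpowc_mulrn fpowc1.
Qed.

(* Substituting [t = e^u - 1] in the residue which is the left-hand side. *)
Lemma bernoulli_log l m a :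
  (finv flogq ^+ (l + m).+1 * fpowc (1 + X) a) l =
  (fpowc (fbern_base K) (- m%:R) * fexp ((a + 1) *: X)) l.
Proof.
(* Since [(e^X - 1)^m = X^m fexpq^m], the wanted coefficient [l] is the coefficient [l + m] of [W],
   to which residue invariance applies. *)
rewrite fpowc_bern_base; set W := fexp ((a + 1) *: X) * (fexp X - 1) ^+ m.
have WE : W (l + m)%N = (fexpq ^+ m * fexp ((a + 1) *: X)) l.
  by rewrite /W fexpq_factor exprMn mulrCA fcoefXnM ltnNge leq_addl addnK mulrC.
rewrite -WE -(residue_subst W (l + m) flog1X_factor flogqV).
have log0 := flog1X_at0.
have Xl : fcomp (fexp X - 1) flog1X = X.
  rewrite fcompB fcomp1// -[Z in fexp Z]scale1r fcomp_fexp_flog.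
  by rewrite fpowc1 ?onePlusX_at0// addrC addKr.
rewrite fcompM// fcomp_exp// Xl fcomp_fexp_flog fpowcD fpowc1 ?onePlusX_at0//.
(* The exponent [a + 1] supplies the factor [1 + X] that cancels the derivative of [log (1 + X)]. *)
have -> : fpowc (1 + X) a * (1 + X) * X ^+ m * fder flog1X * finv flogq ^+ (l + m).+1
  = X ^+ m * (finv flogq ^+ (l + m).+1 * fpowc (1 + X) a) * (fder flog1X * (1 + X)).
  by ring.
by rewrite fder_flog1X mulr1 fcoefXnM ltnNge leq_addl addnK.
Qed.

(** By the chain rule [H' = ((H o fb)' o f) f']; residue invariance for [W = (H o fb)'] then reads
    off coefficient [n] of [W]. *)
Lemma lagrange_inversion H f fb psi phi n : f = X * psi -> phi * psi = 1 ->
  fb 0%N = 0 -> fcomp f fb = X ->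
  fcomp H fb n.+1 *+ n.+1 = (fder H * phi ^+ n.+1) n.
Proof.
move=> fE phipsi fb0 ffb; have f0 : f 0%N = 0 by rewrite fE fcoefXM.
have fb1 : fb 1%N != 0.
  have := congr1 (fun u : fps K => u 1%N) ffb.
  rewrite fcompE !big_ord_recl big_ord0 addr0 /= f0 scale0r add0r fcoefZ.
  rewrite /bump /= expr1 => /eqP.
  by apply: contraTneq => ->; rewrite mulr0 eq_sym oner_eq0.
(* Cancelling [fb] on the right turns the given [f o fb = X] into an identity about composition with
   [f]. *)
have HE : H = fcomp (fcomp H fb) f.
  by apply: (fcomp_inj fb0 fb1); rewrite fcompA// ffb fcompXr.
by rewrite {2}HE fder_fcomp// (residue_subst _ _ fE phipsi).
Qed.

End CharZero.

Theorem theorem6 (K : fieldType) (char0 : [pchar K] =i pred0)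
  (lam alpha c : K) (hlam : lam != 1) (hc : c != 0)
  (S : nat -> {poly K}) (HS : sheffer (gser lam alpha) (fser c) S)
  (n : nat) (hn : (1 <= n)%N) (x : K) :
  (S n).[x] =
    \sum_(l < n) ('C(n.-1, l))%:R
       * bernoulli_ord (l%:R - n%:R + 1) l (c * n%:R + 1)
       * frob_euler lam alpha (n - l) x.
Proof.
case: HS => g0 [_ [_ [fb [fb0 [ffb SE]]]]]; case: n hn => // n _.
set H := finv (gser lam alpha) * fexp (x *: X).
(* [psi] is [f / X] and [phi] is [X / f], as Lagrange inversion requires. *)
set psi := flogq K * fpowc (1 + X) (- c).
set phi := finv (flogq K) * fpowc (1 + X) c.
have fserE : fser c = X * psi by rewrite mulrA -flog1X_factor.
have phipsi : phi * psi = 1.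
  by rewrite mulrACA flogqV// mul1r -fpowcD// addrN fpowc0.
have HE : fcomp H fb n.+1 = (S n.+1).[x] / (n.+1)`!%:R.
  have -> : fcomp H fb = fcomp (finv (gser lam alpha)) fb * fexp (x *: fb).
    by rewrite fcompM// fcomp_fexp ?scaleX_at0// fcompZ fcompX.
  (* Inversion commutes with composition: the composed inverse is an inverse of the composed
     series. *)
  rewrite SE (@finv_unique _ (fcomp (gser lam alpha) fb)
    (fcomp (finv (gser lam alpha)) fb))//.
  by rewrite -fcompM// finvP// fcomp1.
have := lagrange_inversion char0 H n fserE phipsi fb0 ffb; rewrite {}HE.
move=> /(congr1 ( *%R n`!%:R)).
have -> : n`!%:R * ((S n.+1).[x] / (n.+1)`!%:R *+ n.+1) = (S n.+1).[x].
  by rewrite mulrC mulrnAl -mulrnAr -mulrnA mulnC -factS mulfVK ?fact_neq0.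
(* The factors are swapped so that [l] indexes the Bernoulli coefficients and [n - l] those of
   [H']. *)
move=> ->; rewrite mulrC [fder H * _]mulrC fcoefM mulr_suml; apply: eq_bigr => l _.
have le_ln : (l <= n)%N by rewrite -ltnS.
rewrite subSn// /bernoulli_ord /frob_euler.
(* [n] is now the predecessor of the index in the theorem, so the order is minus the natural number
   [n - l]. *)
have -> : l%:R - n.+1%:R + 1 = - (n - l)%:R :> K.
  by rewrite natrB// -natr1; ring.
have -> : fmul (fpowc (fbern_base K) (- (n - l)%:R))
    (fexp (fscale (c * n.+1%:R + 1) X)) l = (phi ^+ n.+1) l.
  (* Here [m = n - l] and [a = c * n.+1], so that [(l + m).+1] is the exponent [n.+1] of [phi]. *)
  rewrite -[LHS]/((fpowc _ _ * fexp (_ *: X)) l) -bernoulli_log// subnKC//.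
  by rewrite exprMn -fpowc_mulrn// mulr_natr.
rewrite -finv_gser// -[fmul (finv _) _ _]/(H _).
(* The derivative contributes [n - l + 1], which completes [(n - l)!] to the factorial in the
   Frobenius-Euler term. *)
rewrite /fder -mulr_natr -(bin_fact le_ln) [(n - l).+1`!]factS !natrM /=.
ring.
Qed.
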